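(* Let $q,N\in\mathbb{N}$, let $\Pi_i=[(\pi_1)_i,(\pi_2)_i,\ldots,(\pi_q)_i]$ $(i=1,\ldots,N)$ be probability vectors, and consider the i.i.d. switched linear system $Y^{k+1}=W_{\sigma_k}Y^k+C$ whose switching probability over the $q^N$ delay configurations is $\Pi_1\otimes\Pi_2\otimes\cdots\otimes\Pi_N\in\mathbb{R}^{1\times q^N}$ (so at each time $k$ the delayed indices $k_1^*,\ldots,k_N^*$ are independent, with $\mathbf{Pr}(k_i^*=k-j+1)=(\pi_j)_i$ for $j=1,\ldots,q$). After implementation of the aggregation algorithm described in the context, which replaces all delayed indices at time $k$ by the oldest one $\xi=\min_{1\le i\le N}k_i^*$, the switching probability becomes $\Pi=[\pi_1,\pi_2,\ldots,\pi_q]\in\mathbb{R}^{1\times q}$, where $\pi_r$ is the probability of mode $r$ (i.e. $\pi_r=\mathbf{Pr}(\xi=k-r+1)$), and $$\pi_r=\prod_{i=1}^{N}\left(\sum_{j=1}^{r}(\pi_j)_i\right)-\left(\sum_{j=1}^{r-1}\pi_j\right),\qquad r=1,2,\ldots,q.$$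
   Context: Setting: $N$ distributed nodes compute subvectors $x_i^k$, and a master node at each time $k$ uses, for node $i$, the possibly delayed value $x_i^{k_i^*}$ with $k_i^*\in\{k,k-1,\ldots,k-q+1\}$, where $q$ is the length of the buffer (maximum delay). The delay distribution of node $i$ is the stationary probability vector $\Pi_i=[(\pi_1)_i,\ldots,(\pi_q)_i]$, where $(\pi_j)_i$ is the probability that $k_i^*=k-j+1$; the delays of different nodes are independent. Each of the $q^N$ possible delay configurations $(k_1^*,\ldots,k_N^* )$ corresponds to one mode (one matrix $W_r$) of the switched system, and the mode sequence $\{\sigma_k\}$ is i.i.d. with the stationary switching probability $\Pi_1\otimes\cdots\otimes\Pi_N$. Aggregation algorithm (Algorithm 1), executed at every time $k$: draw each $k_i^*$ from $\{k,\ldots,k-q+1\}$ according to $\Pi_i$; let $\xi$ be the oldest (smallest) of $k_1^*,\ldots,k_N^*$; use $\tilde x^k=[(x_1^{\xi})^\top,\ldots,(x_N^{\xi})^\top]^\top$, i.e. use the value of time $\xi$ for every node. After this, there are only $q$ modes, mode $r\in\{1,\ldots,q\}$ being the event $\xi=k-r+1$. Empty sums are $0$. *)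

(* Defs.v *)
From HB Require Import structures.
From mathcomp Require Import all_boot all_order all_algebra finmap.
From mathcomp Require Import all_classical all_reals all_analysis.
Set Implicit Arguments.
Unset Strict Implicit.
Unset Printing Implicit Defensive.
Import Order.TTheory GRing.Theory Num.Theory.
Local Open Scope ring_scope.
Local Open Scope classical_set_scope.

(* All 1-based indices of the mathematics are 0-based here: the ordinal
   j : 'I_q stands for the index j + 1 in {1, ..., q}. *)

Definition probability_vector (R : realType) (n : nat) (u : 'rV[R]_n) : Prop :=
  (forall j, 0 <= u 0 j) /\ \sum_j u 0 j = 1.

(* mxvec lists a matrix row by row, so the entry at position i * n + j
   is u_i v_j. *)
Definition kron (R : realType) (m n : nat) (u : 'rV[R]_m) (v : 'rV[R]_n) :
    'rV[R]_(m * n) :=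
  mxvec (u^T *m v).

Fixpoint bigkron (R : realType) (q N : nat) :
    ('I_N -> 'rV[R]_q) -> 'rV[R]_(q ^ N) :=
  match N with
  | 0%N => fun _ => const_mx 1
  | N'.+1 => fun u =>
      castmx (erefl 1%N, esym (expnS q N'))
        (kron (u ord0) (bigkron (fun i => u (lift ord0 i))))
  end.

(* A mode m < q ^ N encodes a delay configuration by its N digits in base q,
   node 0 having the most significant one; this is the ordering of the entries
   of bigkron. The digit of node i is k - k_i^*. *)
Definition delay (q N : nat) (m : 'I_(q ^ N)) (i : 'I_N) : nat :=
  ((m %/ q ^ (N - i.+1)) %% q)%N.

(* Times are integers: k_i^* may be negative for the first few k. *)
Definition delayed_index (q N : nat) (k : nat) (m : 'I_(q ^ N)) (i : 'I_N) :
    int :=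
  k%:Z - (delay m i)%:Z.

(* Every delayed index is at most k, so for N > 0 the initial value k of the
   iterated minimum has no effect. *)
Definition oldest_index (q N : nat) (k : nat) (m : 'I_(q ^ N)) : int :=
  \big[Order.min/k%:Z]_(i < N) delayed_index k m i.

(* E k m is the event that mode m is active at time k. *)
Definition iid_switching (d : measure_display) (T : measurableType d)
    (R : realType) (P : probability T R) (M : nat)
    (E : nat -> 'I_M -> set T) (p : 'rV[R]_M) : Prop :=
  [/\ forall k m, measurable (E k m),
      forall k w, exists! m, E k m w,
      forall k m, P (E k m) = (p 0 m)%:E
    & forall (J : {fset nat}) (m : nat -> 'I_M),
        P (\bigcap_(k in [set` J]) E k (m k)) =
        (\prod_(k <- J) P (E k (m k)))%E].

Definition iid_switched_linear_system (d : measure_display)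
    (T : measurableType d) (R : realType) (P : probability T R) (n M : nat)
    (W : 'I_M -> 'M[R]_n) (C : 'cV[R]_n) (sigma : nat -> T -> 'I_M)
    (Y : nat -> T -> 'cV[R]_n) (p : 'rV[R]_M) : Prop :=
  iid_switching P (fun k m => [set w | sigma k w = m]) p /\
  forall k w, Y k.+1 w = W (sigma k w) *m Y k w + C.

(* After the aggregation, mode r at time k is the event xi = k - r (0-based). *)
Definition aggregated_mode (T : Type) (q N : nat)
    (sigma : nat -> T -> 'I_(q ^ N)) (k : nat) (r : 'I_q) : set T :=
  [set w | oldest_index k (sigma k w) = k%:Z - (val r)%:Z].

(* Main.v *)
(* The oldest index is k minus the largest delay, and the largest delay is at
   most r exactly when every node's delay is; by independence of the nodes the
   distribution function of the aggregated mode at r is therefore the product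
   of the distribution functions of the delays, and pi_r is its increment.
   The aggregated modes are functions of the i.i.d. modes sigma_k, hence
   i.i.d. themselves. *)
Require Import Defs.
From mathcomp Require Import all_boot all_order all_algebra finmap zify.
From mathcomp Require Import all_classical all_reals all_analysis.
Import Order.TTheory GRing.Theory Num.Theory.
Local Open Scope ring_scope.
Local Open Scope classical_set_scope.

(** * Base-q digits of a mode and iterated Kronecker products *)

Lemma index_allpairs_pair (S1 S2 : eqType) (s : seq S1) (t : seq S2) x y :
  x \in s -> y \in t ->
  seq.index (x, y) [seq (a, b) | a <- s, b <- t] =
    (seq.index x s * size t + seq.index y t)%N.
Proof.
elim: s => //= a s IHs; rewrite inE [a == x]eq_sym index_cat size_map.
have inj_pair : injective (fun b : S2 => (a, b)) by move=> b c [].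
have [->|xa] /= := eqVneq x a => [_ yt|xs yt].
  by rewrite (map_f (pair a)) // (index_map inj_pair).
case: ifP => [/mapP[b _ [/eqP]]|_]; first by rewrite (negPf xa).
by rewrite IHs // mulSn addnA.
Qed.

Lemma val_enum_rank (I : finType) (x : I) :
  enum_rank x = seq.index x (enum I) :> nat.
Proof.
by rewrite -[x in RHS](nth_enum_rank x) index_uniq ?enum_uniq // -cardE.
Qed.

(** Makes the row-major position behind [mxvec] explicit, so that base-q digits can be read off it
    by Euclidean division. *)
Lemma val_mxvec_index (m n : nat) (i : 'I_m) (j : 'I_n) :
  mxvec_index i j = (i * n + j)%N :> nat.
Proof.
rewrite /= val_enum_rank [enum _]enumT unlock /= /prod_enum.
by rewrite index_allpairs_pair ?mem_enum // !index_enum_ord size_enum_ord.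
Qed.

Lemma ltn_delay (q N : nat) (m : 'I_(q ^ N)) (i : 'I_N) :
  (delay m i < q)%N.
Proof.
rewrite /delay ltn_mod; case: q m => // m.
(* For q = 0 the node [i] forces N > 0, so 0 ^ N = 0 and no mode [m] exists. *)
have := leq_ltn_trans (leq0n m) (ltn_ord m).
by rewrite exp0n // (leq_trans _ (ltn_ord i)).
Qed.

Lemma delay_mxvec_index0 (q N : nat) (i : 'I_q) (j : 'I_(q ^ N)) :
  delay (cast_ord (esym (expnS q N)) (mxvec_index i j)) ord0 = i.
Proof.
have qN0 : (0 < q ^ N)%N by apply: leq_ltn_trans (ltn_ord j).
rewrite /delay [nat_of_ord (cast_ord _ _)]val_mxvec_index subSS subn0.
by rewrite divnMDl // divn_small // addn0 modn_small.
Qed.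

Lemma delay_mxvec_index_lift (q N : nat) (i : 'I_q) (j : 'I_(q ^ N))
    (l : 'I_N) :
  delay (cast_ord (esym (expnS q N)) (mxvec_index i j)) (lift ord0 l) =
    delay j l.
Proof.
have q0 : (0 < q)%N by apply: leq_ltn_trans (ltn_ord i).
rewrite /delay [nat_of_ord (cast_ord _ _)]val_mxvec_index lift0 subSS.
(* The leading digit contributes a multiple of q even after the division by [q ^ (N - l.+1)], so it
   vanishes modulo q. *)
have -> : (i * q ^ N = (i * q ^ l * q) * q ^ (N - l.+1))%N.
  by rewrite -!mulnA -expnS -expnD subnSK ?subnKC // ltnW.
by rewrite divnMDl ?expn_gt0 ?q0 // modnMDl.
Qed.

(** Independence of the nodes: a Kronecker product gives a box of delay configurations the product
    of its side masses. Induction on N splits off node 0, the leading digit. *)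
Lemma bigkron_cylinder (R : realType) (q N : nat) (u : 'I_N -> 'rV[R]_q)
    (A : 'I_N -> pred nat) :
  \sum_(m | [forall i, A i (delay m i)]) bigkron u 0 m =
  \prod_(i < N) \sum_(j < q | A i j) u i 0 j.
Proof.
elim: N u A => [|N IHN] u A.
  rewrite big_ord0 (bigD1 ord0) /=; last by apply/forallP=> -[].
  by rewrite mxE big1 ?addr0 // => i; rewrite [i]ord1 eqxx andbF.
rewrite big_ord_recl.
rewrite -(IHN (fun i => u (lift ord0 i)) (fun i => A (lift ord0 i))).
rewrite big_distrl; under eq_bigr => i _ do rewrite big_distrr.
rewrite pair_big_dep /=.
have [g gK Kg] := curry_mxvec_bij q (q ^ N).
(* A mode of N + 1 nodes is a leading digit paired with a mode of the other N nodes. *)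
rewrite (reindex (fun x : 'I_q * 'I_(q ^ N) =>
   cast_ord (esym (expnS q N)) (mxvec_index x.1 x.2))) /=; last first.
  exists (fun m => g (cast_ord (expnS q N) m)) => [[i j] _|m _].
    by rewrite cast_ordKV; exact: (gK (i, j)).
  have := Kg (cast_ord (expnS q N) m) isT.
  by case: (g _) => i j /= ->; rewrite cast_ordK.
apply: eq_big => [[i j] /=|[i j] _ /=]; last first.
  rewrite castmxE /= cast_ord_id cast_ordK /kron mxvecE.
  by rewrite !mxE big_ord1 !mxE.
apply/forallP/andP => [H|[Hi /forallP Hj] l].
  split; first by have := H ord0; rewrite delay_mxvec_index0.
  apply/forallP => l.
  by have := H (lift ord0 l); rewrite delay_mxvec_index_lift.
by case: (unliftP ord0 l) => [l' ->|->];
  rewrite ?delay_mxvec_index_lift ?delay_mxvec_index0.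
Qed.

(** * Functions of an i.i.d. mode sequence *)

Section switching.
Context (d : measure_display) (T : measurableType d) (R : realType).
Context (P : probability T R) (M : nat) (sigma : nat -> T -> 'I_M).
Context (p : 'rV[R]_M).
Context (iid_sigma :
  iid_switching P (fun k m => [set w | sigma k w = m]) p).

Let active (k : nat) (A : pred 'I_M) : set T := [set w | A (sigma k w)].

Lemma measurable_active (k : nat) (A : pred 'I_M) : measurable (active k A).
Proof.
have [mE _ _ _] := iid_sigma.
have -> : active k A = \bigcup_(m in [set` A]) [set w | sigma k w = m].
  apply/seteqP; split=> w /=; first by move=> Aw; exists (sigma k w).
  by case=> m Am wm; rewrite /active /= wm.
by apply: fin_bigcup_measurable => // m _; exact: mE.
Qed.

(* The modes of the times in t are already fixed by m; splitting the event
   of a time in s according to the mode moves that time to t. *)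
Lemma prob_bigcap_active_cat (s t : seq nat) (A : nat -> pred 'I_M)
    (m : nat -> 'I_M) :
  uniq (s ++ t) -> (forall k, k \in t -> A k =1 pred1 (m k)) ->
  P (\bigcap_(k in [set` s ++ t]) active k (A k)) =
  (\prod_(k <- s ++ t) \sum_(a | A k a) p 0 a)%:E.
Proof.
have [mE _ PE indepE] := iid_sigma.
elim: s t A m => [|x s IHs] t A m /=.
  move=> ut At.
  (* Every constraint is now a single mode, so the assumed independence applies once the list [t] is
     turned into a finite set. *)
  have -> : \bigcap_(k in [set` t]) active k (A k) =
      \bigcap_(k in [set` [fset k in t]%fset]) [set w | sigma k w = m k].
    apply/seteqP; split=> w /= H k /=; rewrite ?inE => kt.
      by have := H k kt; rewrite /active /= At // => /eqP.
    by rewrite /active /= At //=; apply/eqP/H; rewrite /= inE.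
  rewrite indepE -prodEFin.
  rewrite (perm_big t) /=; last first.
    by apply: uniq_perm; rewrite ?fset_uniq // => k; rewrite inE.
  apply: eq_big_seq => k kt; rewrite PE.
  by under eq_bigl => a do rewrite At //=; rewrite big_pred1_eq.
case/andP=> xst ust At.
pose A' (a : 'I_M) k : pred 'I_M := if k == x then pred1 a : pred 'I_M else A k.
pose m' a k := if k == x then a else m k.
have A'st a k : k \in s ++ t -> A' a k = A k.
  by move=> kst; rewrite /A'; case: eqP kst xst => [-> ->|].
pose F (a : 'I_M) := \bigcap_(k in [set` s ++ x :: t]) active k (A' a k).
have permx : perm_eq (s ++ x :: t) (x :: s ++ t).
  exact: (permEl (perm_catCA s [:: x] t)).
have uxt : uniq (s ++ x :: t) by rewrite (perm_uniq permx) /= xst.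
have memst k : (k \in s ++ x :: t) = (k == x) || (k \in s ++ t).
  by rewrite (perm_mem permx) inE.
have -> : \bigcap_(k in [set` x :: s ++ t]) active k (A k) =
    \big[setU/set0]_(a < M | A x a) F a.
  rewrite -bigcup_pred; apply/seteqP; split=> w /=.
    move=> H; exists (sigma x w); first by have := H x (mem_head _ _).
    move=> k /=; rewrite memst /A' /active /=.
    have [->|kx] /= := eqVneq k x; first by rewrite eqxx.
    by move=> kst; apply: H; rewrite /= inE kst orbT.
  move=> [a Axa H] k; rewrite /= inE => /orP[/eqP ->|kst].
    have := H x; rewrite /= memst eqxx => /(_ isT).
    by rewrite /active /= /A' eqxx /= => /eqP ->.
  by have := H k; rewrite /= memst kst orbT A'st // => /(_ isT).
(* The pieces [F a] are disjoint because [sigma x] takes only one value at each outcome. *)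
rewrite measure_bigsetU_ord_cond; last 2 first.
- move=> a _; apply: fin_bigcap_measurable => // k _; exact: measurable_active.
- move=> a b _ _ [w [Ha Hb]].
  have := Ha x; have := Hb x; rewrite /= memst eqxx /active /A' /= eqxx.
  by move=> /(_ isT) /eqP <- /(_ isT) /eqP.
rewrite big_cons big_distrl /= -sumEFin; apply: eq_bigr => a _.
rewrite (IHs _ _ (m' a)) //; last first.
  move=> k; rewrite inE /A' /m'; case: eqP => //= _; exact: At.
rewrite (perm_big _ permx) /=.
rewrite big_cons; congr (_ * _)%:E.
  by rewrite /A' eqxx big_pred1_eq.
by apply: eq_big_seq => k kst; rewrite A'st.
Qed.

(** Fixing the image mode constrains the original mode to a fibre of [f], and constraints by
    arbitrary sets of modes at distinct times still multiply. *)
Lemma iid_switching_image (Q : nat) (f : 'I_M -> 'I_Q) :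
  iid_switching P (fun k r => [set w | f (sigma k w) = r])
    (\row_r \sum_(m | f m == r) p 0 m).
Proof.
have imE k r : [set w | f (sigma k w) = r] = active k (fun m => f m == r).
  by apply/seteqP; split=> w /= /eqP.
have probE (J : seq nat) (r : nat -> 'I_Q) : uniq J ->
    P (\bigcap_(k in [set` J]) [set w | f (sigma k w) = r k]) =
    (\prod_(k <- J) \sum_(m | f m == r k) p 0 m)%:E.
  move=> uJ; under eq_bigcapr do rewrite imE.
  (* No time is pinned yet, so any mode serves as filler; [sigma k point] supplies one. *)
  have := @prob_bigcap_active_cat J [::] (fun k m => f m == r k)
    (fun k => sigma k point).
  by rewrite cats0; apply.
have prob1 k r : P [set w | f (sigma k w) = r] = (\sum_(m | f m == r) p 0 m)%:E.
  (* The marginal law is the product formula for a single time. *)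
  have := probE [:: k] (fun=> r) isT.
  by rewrite big_seq1 set_cons1 bigcap_set1.
split=> [k r|k w|k r|J r].
- by rewrite imE; exact: measurable_active.
- by exists (f (sigma k w)); split.
- by rewrite prob1 mxE.
- rewrite probE ?fset_uniq // -prodEFin.
  by apply: eq_bigr => k _; rewrite prob1.
Qed.

End switching.

(** * The aggregated modes and their law *)

Lemma oldest_indexE (q N : nat) (k : nat) (m : 'I_(q ^ N)) :
  oldest_index k m = k%:Z - (\max_(i < N) delay m i)%:Z.
Proof.
rewrite /oldest_index.
(* Subtraction from k turns max into min and sends the empty maximum 0 to the initial value k. *)
rewrite (big_morph (fun e : nat => k%:Z - e%:Z)
  (id1 := k%:Z) (op1 := Order.min)) //.
  by move=> a b /=; lia.
by rewrite subr0.
Qed.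

Theorem theorem4p3 (R : realType) (d : measure_display) (T : measurableType d)
    (P : probability T R) (q N n : nat) (hq : (0 < q)%N) (hN : (0 < N)%N)
    (Pis : 'I_N -> 'rV[R]_q)
    (hPis : forall i : 'I_N, probability_vector (Pis i))
    (W : 'I_(q ^ N) -> 'M[R]_n) (C : 'cV[R]_n)
    (sigma : nat -> T -> 'I_(q ^ N)) (Y : nat -> T -> 'cV[R]_n)
    (hsys : iid_switched_linear_system P W C sigma Y (bigkron Pis)) :
  exists Pi : 'rV[R]_q,
    [/\ probability_vector Pi,
        iid_switching P (aggregated_mode sigma) Pi,
        forall (k : nat) (r : 'I_q),
          P (aggregated_mode sigma k r) = (Pi 0 r)%:E
      & forall r : 'I_q,
          Pi 0 r = \prod_(i < N) (\sum_(j < q | (j <= r)%N) Pis i 0 j)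
                   - \sum_(j < q | (j < r)%N) Pi 0 j].
Proof.
have [iid _] := hsys.
have ltmax (m : 'I_(q ^ N)) : (\max_(i < N) delay m i < q)%N.
  rewrite -[ltnRHS](prednK hq) ltnS; apply/bigmax_leqP => i _.
  by rewrite -ltnS prednK ?ltn_delay.
pose mode m := Ordinal (ltmax m).
have modeE : aggregated_mode sigma = fun k r => [set w | mode (sigma k w) = r].
  apply/funext => k; apply/funext => r; apply/seteqP; split=> w /=.
    by rewrite /aggregated_mode /= oldest_indexE => /addrI/oppr_inj[maxr];
      exact: val_inj.
  by move=> <-; rewrite /aggregated_mode /= oldest_indexE.
have := iid_switching_image _ _ _ _ _ _ _ iid _ mode; rewrite -modeE.
set Pi := \row_r _ => iidPi; exists Pi.
have [_ _ probPi _] := iidPi.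
have cdf (r : 'I_q) : \sum_(j < q | (j <= r)%N) Pi 0 j =
    \prod_(i < N) \sum_(j < q | (j <= r)%N) Pis i 0 j.
  rewrite -(bigkron_cylinder _ _ _ _ (fun _ e => (e <= r)%N)).
  (* The box of modes with all delays at most [r] is grouped by the largest delay. *)
  rewrite (partition_big mode (fun j => (j <= r)%N)) /=; last first.
    by move=> m /forallP mr; apply/bigmax_leqP.
  apply: eq_bigr => j jr; rewrite mxE; apply: eq_bigl => m.
  case: eqP => [mj|]; last by rewrite andbF.
  rewrite andbT; apply/esym/forallP => i; apply: leq_trans jr.
  by rewrite -mj /= (leq_bigmax i).
split=> //.
  split=> [j|]; first by rewrite -lee_fin -(probPi 0).
  (* Total mass is the distribution function at the last index q - 1, where the bound on the delays
     is vacuous and each factor is 1. *)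
  have hlt : (q.-1 < q)%N by rewrite prednK.
  have leq_last (j : 'I_q) : (j <= Ordinal hlt)%N by rewrite /= -ltnS prednK.
  have /esym := cdf (Ordinal hlt).
  rewrite big1 => [->|i _]; first by apply: eq_bigl => j; rewrite leq_last.
  by have [_ <-] := hPis i; apply: eq_bigl => j; rewrite leq_last.
(* Removing the term j = r from the sum over j <= r leaves exactly the subtracted sum. *)
move=> r; rewrite -cdf (bigD1 r) //= -addrA -[LHS]addr0; congr (_ + _).
apply/esym/eqP; rewrite subr_eq0; apply/eqP; apply: eq_bigl => j.
by rewrite ltn_neqAle andbC.
Qed.
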